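(* Let $n\ge 5$, and let $S$ be a sequence of length $n$ over the cyclic group $C_n$ of order $n$ with $|\operatorname{supp}(S)|=3$. Then \[ MZ(S)\le n-3. \] This bound is sharp: if $g$ is a generator of $C_n$, then \[ MZ\bigl(g^{[n-2]}(2g)(3g)\bigr)=n-3, \] where $g^{[n-2]}(2g)(3g)$ is the length-$n$ sequence consisting of $n-2$ copies of $g$, one copy of $2g$ and one copy of $3g$.
   Context: Groups are written additively; $C_n$ denotes the cyclic group of order $n$. A sequence $S$ over a finite abelian group $G$ is a finite multiset of elements of $G$ (order irrelevant, repetition allowed); a subsequence is a submultiset of occurrences. The length of $S$ is its number of terms counted with multiplicity, and $\operatorname{supp}(S)$ denotes the set of distinct elements of $G$ occurring in $S$. Sequences are written as formal products of their terms, and $g^{[k]}$ denotes the sequence consisting of $k$ copies of $g$. A subsequence is zero-sum if the sum of its terms (with multiplicity) is $0$. $MZ(S)$ is the smallest positive integer $r$ such that $S$ has a zero-sum subsequence of length $r$; if $S$ has no nonempty zero-sum subsequence, $MZ(S)=\infty$. *)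

(* Defs.v *)
From mathcomp Require Import all_boot all_order all_algebra all_fingroup all_solvable.
From mathcomp Require Import finmap multiset boolp.

Set Implicit Arguments.
Unset Strict Implicit.
Unset Printing Implicit Defensive.

Import GRing.Theory.
Local Open Scope ring_scope.
Local Open Scope mset_scope.

(* A sequence over G is a finite multiset {mset G}: its length is the size of
   its enumeration, and its set of distinct terms is its finsupp. *)

Definition sigma (G : zmodType) (S : {mset G}) : G := \sum_(x <- S) x.

Definition zero_sum (G : zmodType) (S : {mset G}) : Prop := sigma S = 0.

Definition zero_sum_length (G : zmodType) (S : {mset G}) (r : nat) : Prop :=
  (0 < r)%N /\
  exists T : {mset G}, [/\ T `<=` S, size T = r & zero_sum T].

(* None stands for the value infinity. *)
Definition MZ (G : zmodType) (S : {mset G}) : option nat :=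
  if pselect (exists r, `[< zero_sum_length S r >]) is left ex_r
  then Some (ex_minn ex_r) else None.

Definition enat_le (x y : option nat) : bool :=
  match x, y with
  | _, None => true
  | None, Some _ => false
  | Some a, Some b => (a <= b)%N
  end.

(* Main.v *)
(* Write S = x^a y^b z^c with a + b + c = n.  The sums of the subsequences of a
   zero-sum-free sequence grow by at least one with each new term, and
   x^2 y^2 z already has at least 9 sums.  So if a, b >= 2 and n >= 8, a
   zero-sum-free subsequence of length n - 3 containing x^2 y^2 z would have at
   least 9 + (n - 8) > n sums.  If b = c = 1, then either x is not a generator
   and some n / d copies of x sum to zero, or y = kx and z = lx, where k >= 4
   (or l >= 4) gives a zero-sum by adding n - k copies of x, and {k, l} = {2, 3}
   gives x^(n-5) y z.  The cases n = 5, 6, 7 are checked by computation.  For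
   sharpness, a zero-sum g^i (2g)^j (3g)^k has i + 2j + 3k = n with j, k <= 1,
   hence length n - j - 2k >= n - 3. *)
Require Import Defs.
From mathcomp Require Import all_boot all_order all_algebra all_fingroup all_solvable.
From mathcomp Require Import finmap multiset boolp zify.

Set Implicit Arguments.
Unset Strict Implicit.
Unset Printing Implicit Defensive.

Import GRing.Theory.

Local Open Scope fset_scope.
Local Open Scope mset_scope.
Local Open Scope nat_scope.

(** * Sequences with three distinct terms, described by their multiplicities *)

Definition short_zero_sum (G : zmodType) (x y z : G) (a b c L : nat) : Prop :=
  exists i j k, [/\ i <= a, j <= b, k <= c, 0 < i + j + k <= L &
                   (x *+ i + y *+ j + z *+ k = 0)%R].

Section ThreeTermMultisets.
Variables (G : zmodType) (x y z : G).
Hypotheses (xy : x != y) (xz : x != z) (yz : y != z).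

Local Notation mset3 a b c := (msetn a x `+` msetn b y `+` msetn c z).

Lemma perm_msetD (A B : {mset G}) : perm_eq (A `+` B) ((A : seq G) ++ (B : seq G)).
Proof. by apply/allP => u _ /=; rewrite count_cat !count_mem_mset msetE2. Qed.

Lemma perm_mset3 a b c :
  perm_eq (mset3 a b c) (nseq a x ++ nseq b y ++ nseq c z).
Proof.
rewrite -!enum_msetn catA (permPl (perm_msetD _ _)) perm_cat2r.
exact: perm_msetD.
Qed.

Lemma size_mset3 a b c : size (mset3 a b c) = a + b + c.
Proof. by rewrite (perm_size (perm_mset3 a b c)) !size_cat !size_nseq addnA. Qed.

Lemma sigma_mset3 a b c : sigma (mset3 a b c) = (x *+ a + y *+ b + z *+ c)%R.
Proof.
rewrite /sigma (perm_big _ (perm_mset3 a b c)) /= !big_cat /= !big_nseq.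
by rewrite -!Monoid.iteropE !addrA.
Qed.

Lemma mset3_counts (T : {mset G}) :
  (forall u, u \in T -> u \in [:: x; y; z]) -> T = mset3 (T x) (T y) (T z).
Proof.
move=> Tsub; apply/msetP => u; rewrite !msetE2 !msetnE.
have [->|ux] := eqVneq u x; first by rewrite (negPf xy) (negPf xz) !addn0.
have [->|uy] := eqVneq u y; first by rewrite (negPf yz) addn0.
have [->//|uz] := eqVneq u z.
by apply/mset_eq0P/negP => /Tsub; rewrite !inE (negPf ux) (negPf uy) (negPf uz).
Qed.

(** Since [x], [y], [z] are distinct, a submultiset is determined by its three multiplicities, so
    the search for zero-sums becomes a search over triples. *)
Lemma zero_sum_length_mset3P a b c r :
  zero_sum_length (mset3 a b c) r <->
  exists i j k, [/\ i <= a, j <= b, k <= c, 0 < r /\ r = i + j + k &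
                   (x *+ i + y *+ j + z *+ k = 0)%R].
Proof.
split=> [[r0 [T [TS sT zT]]]|[i [j [k [ia jb kc [r0 rE] zs]]]]].
  have Tle u : T u <= mset3 a b c u by apply/msubsetP: u.
  have TE : T = mset3 (T x) (T y) (T z).
    apply: mset3_counts => u; rewrite in_mset => Tu.
    have := leq_trans Tu (Tle u); rewrite !msetE2 !msetnE !inE.
    by do 3?case: (u == _).
  exists (T x), (T y), (T z); split.
  - by have := Tle x; rewrite !msetE2 !msetnE eqxx (negPf xy) (negPf xz) !addn0.
  - have := Tle y.
    by rewrite !msetE2 !msetnE eqxx eq_sym (negPf xy) (negPf yz) addn0.
  - have := Tle z; rewrite !msetE2 !msetnE eqxx.
    by rewrite ![z == _]eq_sym (negPf xz) (negPf yz).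
  - by rewrite -size_mset3 -TE.
  - by rewrite -sigma_mset3 -TE.
split=> //; exists (mset3 i j k); split.
- apply: msetDSS; last by apply/msubsetP => u; rewrite !msetnE; case: ifP.
  by apply: msetDSS; apply/msubsetP => u; rewrite !msetnE; case: ifP.
- by rewrite size_mset3.
- by rewrite /zero_sum sigma_mset3.
Qed.

End ThreeTermMultisets.

(** * Bounding and computing the minimum [MZ] *)

Lemma MZ_le (G : zmodType) (S : {mset G}) r m :
  zero_sum_length S r -> r <= m -> enat_le (MZ S) (Some m).
Proof.
move=> Sr rm; rewrite /MZ; case: pselect => [ex_r|[]]; last first.
  by exists r; apply/asboolP.
by case: ex_minnP => k _ /(_ r) /=; move/(_ (asboolT Sr))/leq_trans; apply.
Qed.

Lemma MZ_eq (G : zmodType) (S : {mset G}) m :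
  zero_sum_length S m -> (forall r, zero_sum_length S r -> m <= r) ->
  MZ S = Some m.
Proof.
move=> Sm minm; rewrite /MZ; case: pselect => [ex_r|[]]; last first.
  by exists m; apply/asboolP.
case: ex_minnP => k /asboolP /minm mk /(_ m (asboolT Sm)) km.
by congr Some; apply/eqP; rewrite eqn_leq km mk.
Qed.

(** * Counting the subsequence sums of a zero-sum-free sequence *)

Section BoxSums.
Variable G : finZmodType.
Implicit Types x y z u : G.

Definition box_sums x y z a b c : {set G} :=
  [set (x *+ p.1.1 + y *+ p.1.2 + z *+ p.2)%R | p : 'I_a.+1 * 'I_b.+1 * 'I_c.+1]%SET.

Lemma box_sumsP x y z a b c u :
  reflect (exists i j k, [/\ i <= a, j <= b, k <= c &
                            u = (x *+ i + y *+ j + z *+ k)%R])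
          (u \in box_sums x y z a b c).
Proof.
apply: (iffP imsetP) => [[[[i j] k] _ ->]|[i [j [k [ia jb kc ->]]]]].
  exists (val i), (val j), (val k).
  by split; [exact: (ltn_ord i) | exact: (ltn_ord j) | exact: (ltn_ord k) |].
by exists (Ordinal (ia : i < a.+1),
           Ordinal (jb : j < b.+1), Ordinal (kc : k < c.+1)).
Qed.

Lemma box_sums_swap12 x y z a b c : box_sums x y z a b c = box_sums y x z b a c.
Proof.
apply/setP => u; apply/box_sumsP/box_sumsP => -[i [j [k [ia jb kc ->]]]];
  by exists j, i, k; split=> //; rewrite [(_ *+ i + _)%R]addrC.
Qed.

Lemma box_sums_swap13 x y z a b c : box_sums x y z a b c = box_sums z y x c b a.
Proof.
apply/setP => u; apply/box_sumsP/box_sumsP => -[i [j [k [ia jb kc ->]]]];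
  by exists k, j, i; split=> //; rewrite addrC [RHS]addrAC addrA.
Qed.

Definition zero_sum_free3 x y z a b c : Prop :=
  forall i j k, i <= a -> j <= b -> k <= c ->
    (x *+ i + y *+ j + z *+ k = 0)%R -> i + j + k = 0.

Lemma zero_sum_free3_swap12 x y z a b c :
  zero_sum_free3 x y z a b c -> zero_sum_free3 y x z b a c.
Proof.
move=> Z i j k ib ja kc E; rewrite (addnC i).
by apply: Z; rewrite // [(x *+ _ + _)%R]addrC.
Qed.

Lemma zero_sum_free3_swap13 x y z a b c :
  zero_sum_free3 x y z a b c -> zero_sum_free3 z y x c b a.
Proof.
move=> Z i j k ic jb ka E; have -> : i + j + k = k + j + i by lia.
by apply: Z => //; apply: etrans E; rewrite [LHS]addrC [(x *+ _ + _)%R]addrC addrA.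
Qed.

Lemma zero_sum_free3W x y z a b c a' b' c' :
  a' <= a -> b' <= b -> c' <= c ->
  zero_sum_free3 x y z a b c -> zero_sum_free3 x y z a' b' c'.
Proof.
by move=> aa bb cc Z i j k ia jb kc; apply: Z;
   [apply: leq_trans aa | apply: leq_trans bb | apply: leq_trans cc].
Qed.

(* If adding a copy of [x] creates no new sum, the sums are stable under
   translation by [x], hence contain [- x] because they contain [0]. *)
Lemma card_box_sumsS x y z a b c :
  zero_sum_free3 x y z a.+1 b c ->
  #|box_sums x y z a b c| < #|box_sums x y z a.+1 b c|.
Proof.
move=> Z; apply: proper_card; rewrite properEneq; apply/andP; split; last first.
  apply/subsetP => u /box_sumsP[i [j [k [ia jb kc ->]]]].
  by apply/box_sumsP; exists i, j, k; split=> //; apply: leqW.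
apply/negP => /eqP E; set A := box_sums x y z a b c in E.
have stab u : u \in A -> (x + u)%R \in A.
  case/box_sumsP => i [j [k [ia jb kc ->]]]; rewrite E.
  by apply/box_sumsP; exists i.+1, j, k; split; rewrite // mulrS !addrA.
have A0 m : (x *+ m)%R \in A.
  elim: m => [|m IH]; last by rewrite mulrS stab.
  by apply/box_sumsP; exists 0, 0, 0; rewrite !mulr0n !addr0.
have : (- x)%R \in A.
  (* Finiteness of the group makes [- x] a natural multiple of [x], one less than its order. *)
  have [m ->] : exists m, (- x = x *+ m)%R; last exact: A0.
  exists (#[x]%g.-1); apply/eqP; rewrite eq_sym -subr_eq0 opprK -mulrSr.
  by rewrite prednK ?order_gt0 // -FinRing.zmodXgE expg_order.
(* One more copy of [x] turns a representation of [- x] into a nonempty zero-sum. *)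
case/box_sumsP => i [j [k [ia jb kc xE]]].
suff: i.+1 + j + k = 0 by [].
by apply: Z => //; rewrite mulrS -!addrA [(x *+ i + _)%R]addrA -xE subrr.
Qed.

Lemma card_box_sumsD x y z a b c d :
  zero_sum_free3 x y z (a + d) b c ->
  #|box_sums x y z a b c| + d <= #|box_sums x y z (a + d) b c|.
Proof.
elim: d => [|d IH Z]; first by rewrite !addn0.
rewrite !addnS (leq_trans _ (card_box_sumsS _)) ?ltnS -?addnS //.
by apply/IH/(zero_sum_free3W _ _ _ Z); rewrite ?leq_add2l.
Qed.

(** The box is enlarged in one direction at a time; the swaps bring the growing coordinate to the
    front, where [card_box_sumsD] applies. *)
Lemma card_box_sums_ge x y z a b c a' b' c' :
  a' <= a -> b' <= b -> c' <= c -> zero_sum_free3 x y z a b c ->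
  #|box_sums x y z a' b' c'| + (a - a') + (b - b') + (c - c')
    <= #|box_sums x y z a b c|.
Proof.
move=> aa bb cc Z.
have Z1 : zero_sum_free3 x y z (a' + (a - a')) b' c'.
  by rewrite subnKC //; apply: zero_sum_free3W Z.
have Z2 : zero_sum_free3 y x z (b' + (b - b')) a c'.
  by rewrite subnKC //; apply: zero_sum_free3_swap12; apply: zero_sum_free3W Z.
have Z3 : zero_sum_free3 z y x (c' + (c - c')) b a.
  by rewrite subnKC //; apply: zero_sum_free3_swap13.
have := card_box_sumsD Z3; have := card_box_sumsD Z2; have := card_box_sumsD Z1.
rewrite !subnKC // ![box_sums z _ _ _ _ _]box_sums_swap13.
rewrite ![box_sums y _ _ _ _ _]box_sums_swap12 => h1 h2 h3.
by apply: leq_trans h3; rewrite leq_add2r; apply: leq_trans h2; rewrite leq_add2r.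
Qed.

(** With [y = 2x] the copies of [x] and [y] produce [0, x, ..., 6x], and [5x + z], [6x + z] are two
    further sums. A coincidence [mx + z = kx] with [k <= m] would be a zero-sum; choosing [m] as 5
    or 6 leaves only [k = m + 1], which forces [x = z]. *)
Lemma card_box_sums_double x y z :
  y = (x *+ 2)%R -> x != z -> zero_sum_free3 x y z 2 2 1 ->
  9 <= #|box_sums x y z 2 2 1|.
Proof.
move=> yE xz Z.
have split2 m : m <= 6 -> exists i j, [/\ i <= 2, j <= 2 & m = i + j * 2].
  by move=> m6; exists (m - (minn 2 m./2).*2), (minn 2 m./2); split; lia.
have yM i j : (x *+ i + y *+ j = x *+ (i + j * 2))%R.
  by rewrite yE -mulrnA mulnC -mulrnDr.
have xz0 m k : m <= 6 -> k <= 1 -> (x *+ m + z *+ k = 0)%R -> m + k = 0.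
  move=> /split2[i [j [i2 j2 ->]]] k1; rewrite -yM => /(Z _ _ _ i2 j2 k1); lia.
have x_neq m : 0 < m <= 6 -> (x *+ m)%R != 0%R.
  case/andP=> m0 m6; apply/eqP => E.
  by have := xz0 m 0 m6 isT; rewrite addr0 addn0 E => /(_ erefl); lia.
have xz_neq m : m <= 6 -> (x *+ m + z)%R != 0%R.
  by move=> m6; apply/eqP => E; have := xz0 m 1 m6 isT E; rewrite addn1.
have xI m m' : m <= m' <= 6 -> (x *+ m = x *+ m')%R -> m = m'.
  move=> /andP[mm m6] E; apply/eqP; rewrite eqn_leq mm leqNgt; apply/negP => lt.
  have d6 : 0 < m' - m <= 6 by lia.
  case/eqP: (x_neq _ d6).
  by rewrite mulrnBr // E subrr.
pose s := [seq (x *+ m)%R | m <- iota 0 7] ++ [:: (x *+ 6 + z)%R; (x *+ 5 + z)%R].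
have s_uniq : uniq s.
  have notin m : m \in [:: 5; 6] ->
      (x *+ m + z)%R \notin [seq (x *+ k)%R | k <- iota 0 7].
    move=> m56; apply/mapP => -[k]; rewrite mem_iota => /andP[_ k7] E.
    have [km|mk] := leqP k m.
      have d6 : m - k <= 6 by move: m56; rewrite !inE; lia.
      case/eqP: (xz_neq _ d6).
      by rewrite mulrnBr // addrAC E subrr.
    case/eqP: xz; have kE : k = m.+1 by move: m56; rewrite !inE; lia.
    by move: E; rewrite kE mulrSr => /addrI.
  rewrite /s cat_uniq; apply/and3P; split.
  - rewrite map_inj_in_uniq ?iota_uniq // => m m'.
    rewrite !mem_iota => /andP[_ m7] /andP[_ m7'] E.
    have [mm|/ltnW mm] := leqP m m'; first by apply: xI; rewrite // mm.
    by apply/esym/xI; rewrite // mm.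
  - by rewrite /= !(negPf (notin _ _)).
  - rewrite /= inE andbT; apply/eqP => /addIr /esym /xI => /(_ isT); lia.
have -> : 9 = #|s| by rewrite (card_uniqP s_uniq) size_cat size_map.
apply/subset_leq_card/subsetP => u; rewrite mem_cat => /orP[/mapP[m]|].
  rewrite mem_iota => /andP[_ m7] ->; have [i [j [i2 j2 ->]]] := split2 m m7.
  by apply/box_sumsP; exists i, j, 0; split; rewrite // yM addr0.
rewrite !inE => /orP[]/eqP->; apply/box_sumsP.
  by exists 2, 2, 1; rewrite yM.
by exists 1, 2, 1; rewrite yM.
Qed.

(** Among the nine sums [ix + jy] with [i, j <= 2] the only possible coincidence is [2x = 2y].
    Discarding [2y] leaves eight distinct sums, and the term [z] contributes at least one more. *)
Lemma card_box_sums_generic x y z :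
  x != y -> y != (x *+ 2)%R -> x != (y *+ 2)%R -> zero_sum_free3 x y z 2 2 1 ->
  9 <= #|box_sums x y z 2 2 1|.
Proof.
move=> xy yx2 xy2 Z.
have inj i j i' j' : i <= i' <= 2 -> j <= 2 -> j' <= 2 ->
    (x *+ i + y *+ j = x *+ i' + y *+ j')%R ->
    i = i' /\ j = j' \/ [/\ i = 0, j = 2, i' = 2 & j' = 0].
  (* If both multiplicities increase weakly, the difference is a zero-sum. Otherwise a multiple of
     [x] equals a multiple of [y], with both coefficients at most 2, and the hypotheses exclude all
     nontrivial cases but [2x = 2y]. *)
  move=> /andP[ii i2] j2 j2'; have [jj|/ltnW jj] := leqP j j'.
    move=> E; left; suff: (i' - i) + (j' - j) + 0 = 0 by lia.
    apply: Z; rewrite ?mulr0n ?addr0; [lia | lia | by [] |].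
    by rewrite !mulrnBr // addrACA -opprD -E subrr.
  move=> E.
  have {E} : (x *+ (i' - i) = y *+ (j - j'))%R.
    apply/eqP; rewrite !mulrnBr // subr_eq addrAC eq_sym subr_eq eq_sym.
    by rewrite [(y *+ j + _)%R]addrC E.
  have : i' - i <= 2 by lia.
  have : j - j' <= 2 by lia.
  have dE : i' = i + (i' - i) by lia.
  have eE : j = j' + (j - j') by lia.
  have x0 m : m <= 2 -> (x *+ m = 0)%R -> m = 0.
    by move=> m2 xm; have := Z m 0 0 m2 isT isT; rewrite !addr0 !addn0; apply.
  have y0 m : m <= 2 -> (y *+ m = 0)%R -> m = 0.
    by move=> m2 xm; have := Z 0 m 0 isT m2 isT; rewrite add0r addr0 addn0; apply.
  move: (i' - i) (j - j') dE eE => [|[|[|//]]] [|[|[|//]]] dE eE _ _ E.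
  - by left; lia.
  - by have := y0 1 isT (esym E).
  - by have := y0 2 isT (esym E).
  - by have := x0 1 isT E.
  - by case/eqP: xy.
  - by case/eqP: xy2.
  - by have := x0 2 isT E.
  - by case/eqP: yx2.
  - by right; split; lia.
pose D := [set~ (ord0, ord_max) : 'I_3 * 'I_3]%SET.
pose f (p : 'I_3 * 'I_3) := (x *+ p.1 + y *+ p.2)%R.
have f_inj : {in D &, injective f}.
  move=> [i j] [i' j']; rewrite !inE /f => ne ne' /= E.
  have i2 := ltn_ord i; have i2' := ltn_ord i'.
  have j2 := ltn_ord j; have j2' := ltn_ord j'.
  have [ii|/ltnW ii] := leqP i i'.
    case: (inj i j i' j') => //; first by rewrite ii.
      by case=> ? ?; congr pair; apply: val_inj.
    by case=> i0 j0 _ _; case/eqP: ne; congr pair; apply: val_inj.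
  case: (inj i' j' i j) => //; first by rewrite ii.
    by case=> ? ?; congr pair; apply: val_inj.
  by case=> i0 j0 _ _; case/eqP: ne'; congr pair; apply: val_inj.
have := card_box_sums_ge (leqnn 2) (leqnn 2) (leq0n 1) Z.
rewrite !subnn !addn0; apply: leq_trans; rewrite -[9]/(8 + 1) leq_add2r.
have -> : 8 = #|[set f p | p in D]%SET|.
  by rewrite (card_in_imset f_inj) cardsC1 card_prod !card_ord.
apply/subset_leq_card/subsetP => _ /imsetP[p _ ->].
apply/box_sumsP; exists (val p.1), (val p.2), 0.
by split; [exact: (ltn_ord p.1) | exact: (ltn_ord p.2) | | rewrite addr0].
Qed.

Lemma card_box_sums221 x y z :
  x != y -> x != z -> y != z -> zero_sum_free3 x y z 2 2 1 ->
  9 <= #|box_sums x y z 2 2 1|.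
Proof.
move=> xy xz yz Z.
have [yE|yx2] := eqVneq y (x *+ 2)%R; first exact: card_box_sums_double.
have [xE|xy2] := eqVneq x (y *+ 2)%R; last exact: card_box_sums_generic.
rewrite box_sums_swap12; apply: card_box_sums_double => //.
exact: zero_sum_free3_swap12.
Qed.

(** Zero-sum-freeness would give at least [9 + (a + b + c - 5) = a + b + c + 4] distinct sums, more
    than the group has elements. *)
Lemma not_zero_sum_free3 x y z a b c :
  x != y -> x != z -> y != z -> 2 <= a -> 2 <= b -> 1 <= c ->
  #|G| < a + b + c + 4 -> ~ zero_sum_free3 x y z a b c.
Proof.
move=> xy xz yz a2 b2 c1 cardG Z.
have := card_box_sums_ge a2 b2 c1 Z.
have := card_box_sums221 xy xz yz (zero_sum_free3W a2 b2 c1 Z).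
have := max_card (mem (box_sums x y z a b c)).
by move: #|box_sums x y z a b c| #|box_sums x y z 2 2 1| #|G| cardG; lia.
Qed.

Lemma short_zero_sum_not_free x y z a b c a' b' c' L :
  a' <= a -> b' <= b -> c' <= c -> a' + b' + c' <= L ->
  ~ zero_sum_free3 x y z a' b' c' -> short_zero_sum x y z a b c L.
Proof.
move=> aa bb cc sL nZ; apply: contrapT => H; apply: nZ => i j k ia jb kc E.
apply/eqP; rewrite -leqn0 leqNgt; apply/negP => gt0; apply: H.
by exists i, j, k; split; rewrite ?gt0 //; lia.
Qed.

End BoxSums.

(** * Symmetries, and cyclic groups with multiplicities [n - 2], 1, 1 *)

Lemma short_zero_sum_swap12 (G : zmodType) (x y z : G) a b c L :
  short_zero_sum x y z a b c L -> short_zero_sum y x z b a c L.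
Proof.
case=> i [j [k [ia jb kc sL E]]]; exists j, i, k; split=> //; first by rewrite (addnC j).
by rewrite [(y *+ j + _)%R]addrC.
Qed.

Lemma short_zero_sum_swap13 (G : zmodType) (x y z : G) a b c L :
  short_zero_sum x y z a b c L -> short_zero_sum z y x c b a L.
Proof.
case=> i [j [k [ia jb kc sL E]]]; exists k, j, i; split=> //; first by lia.
by apply: etrans E; rewrite [LHS]addrC [(z *+ _ + _)%R]addrC addrA.
Qed.

Section Cyclic.
Variable n : nat.
Hypothesis n_ge5 : 5 <= n.

Let n_gt1 : 1 < n. Proof. by lia. Qed.

Implicit Types x y z : 'Z_n.

Lemma natr_Zn_eq0 m : (m%:R == 0 :> 'Z_n)%R = (n %| m).
Proof. by rewrite -val_eqE /= val_Zp_nat. Qed.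

(** Passing to natural representatives turns zero-sums into divisibilities, which can be decided by
    computation. *)
Lemma linear_Zn_eq0 x y z i j k :
  (x *+ i + y *+ j + z *+ k = 0)%R <-> n %| i * x + j * y + k * z.
Proof.
rewrite -natr_Zn_eq0 !natrD !natrM !natr_Zp !mulr_natl.
by split=> [->|/eqP].
Qed.

Lemma ltn_Zn x : x < n.
Proof. by rewrite -[n in _ < n](Zp_cast n_gt1) ltn_ord. Qed.

(* Up to the automorphism of ['Z_n] sending [x] to [1], the multiset is
   [1^(n-2) k l], and a term [k >= 4] is completed by [n - k] ones. *)
Lemma short_zero_sum_two_singletons x y z :
  x != y -> x != z -> y != z -> short_zero_sum x y z (n - 2) 1 1 (n - 3).
Proof.
move=> xy xz yz.
have [ux|] := boolP (coprime n x); last first.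
  move=> ncop; pose d := gcdn n x.
  have d_gt1 : 1 < d.
    by rewrite ltn_neqAle eq_sym ncop gcdn_gt0; lia.
  have dn : n %/ d * d = n by apply: divnK; apply: dvdn_gcdl.
  have q_gt0 : 0 < n %/ d by move: dn; case: (n %/ d); lia.
  have q2 : n %/ d * 2 <= n by rewrite -[leqRHS]dn leq_mul2l d_gt1 orbT.
  (* Since [d >= 2], the number [n %/ d] of copies is at most half of [n], hence at most [n - 3]
     because [n >= 5]. *)
  exists (n %/ d), 0, 0; split; [lia | by [] | by [] | lia |].
  apply/linear_Zn_eq0; rewrite !mul0n !addn0.
  have /dvdnP[e ->] : d %| x by apply: dvdn_gcdr.
  by rewrite mulnCA dn dvdn_mull.
have unitx : x \is a GRing.unit by rewrite -[x]natr_Zp unitZpE.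
have multiple u : exists2 k, k < n & u = (x *+ k)%R.
  exists (val (u / x)%R); first exact: ltn_Zn.
  by rewrite -mulr_natr natr_Zp mulrCA divrr ?mulr1.
have xn : (x *+ n = 0)%R by rewrite -mulr_natr pchar_Zp ?mulr0.
have [k k_lt yE] := multiple y; have [l l_lt zE] := multiple z.
(* The bound [n - 4] leaves room for [u] itself within length [n - 3]. *)
have complete u m : m < n -> u = (x *+ m)%R -> (m == 0) || (4 <= m) ->
    exists2 i, i <= n - 4 & (x *+ i + u = 0)%R.
  move=> m_lt -> /orP[/eqP->|m4]; first by exists 0; rewrite // mulr0n addr0.
  by exists (n - m); [lia | rewrite -mulrnDr subnK // ltnW].
have k1 : k != 1 by apply: contraNneq xy => k1; rewrite yE k1.
have l1 : l != 1 by apply: contraNneq xz => l1; rewrite zE l1.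
have kl : k != l by apply: contraNneq yz => kl; rewrite yE zE kl.
have [/(complete _ _ k_lt yE)[i i_le E]|k23] := boolP ((k == 0) || (4 <= k)).
  by exists i, 1, 0; split; [lia | by [] | by [] | lia | rewrite addr0].
have [/(complete _ _ l_lt zE)[i i_le E]|l23] := boolP ((l == 0) || (4 <= l)).
  by exists i, 0, 1; split; [lia | by [] | by [] | lia | rewrite addr0].
(* Now [k] and [l] are 2 and 3 in some order, so [y + z = 5x]. *)
exists (n - 5), 1, 1; split; [lia | by [] | by [] | lia |].
rewrite !mulr1n yE zE -!mulrnDr -addnA.
have -> : k + l = 5 by lia.
by rewrite subnK.
Qed.

End Cyclic.

(** * Small orders by computation, large orders by counting *)

Definition short_zero_sumb n x y z a b c L : bool :=
  has (fun i => has (fun j => has (fun k =>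
    (0 < i + j + k <= L) && (n %| i * x + j * y + k * z))
    (iota 0 c.+1)) (iota 0 b.+1)) (iota 0 a.+1).

(** Everything is phrased with natural numbers and lists, so that [vm_compute] can evaluate it; the
    third multiplicity is [n - a - b], positive by the guard. *)
Definition all_short_zero_sumb n : bool :=
  all (fun x => all (fun y => all (fun z =>
    [&& x != y, x != z & y != z] ==>
      all (fun a => all (fun b => (a + b < n) ==>
        short_zero_sumb n x y z a b (n - a - b) (n - 3))
      (iota 1 n)) (iota 1 n)) (iota 0 n)) (iota 0 n)) (iota 0 n).

Lemma all_short_zero_sumb_small n : 5 <= n < 8 -> all_short_zero_sumb n.
Proof.
move=> n58; have [->|[->|->]] : n = 5 \/ n = 6 \/ n = 7 by lia.
- by vm_compute.
- by vm_compute.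
- by vm_compute.
Qed.

Lemma short_zero_sum_small n (x y z : 'Z_n) a b c :
  5 <= n < 8 -> x != y -> x != z -> y != z ->
  0 < a -> 0 < b -> 0 < c -> a + b + c = n ->
  short_zero_sum x y z a b c (n - 3).
Proof.
move=> n58 xy xz yz a0 b0 c0 abc; have [n5 n8] := andP n58.
have mem_Zn (u : 'Z_n) : val u \in iota 0 n by rewrite mem_iota ltn_Zn.
have /allP/(_ _ (mem_Zn x))/allP/(_ _ (mem_Zn y))/allP/(_ _ (mem_Zn z)) :=
  all_short_zero_sumb_small n58.
rewrite !val_eqE xy xz yz /= => /allP/(_ a); rewrite mem_iota => /(_ ltac:(lia)).
move=> /allP/(_ b); rewrite mem_iota => /(_ ltac:(lia)) /implyP/(_ ltac:(lia)).
have -> : n - a - b = c by lia.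
case/hasP=> i; rewrite mem_iota => ia /hasP[j]; rewrite mem_iota => jb.
case/hasP=> k; rewrite mem_iota => kc /andP[sL dv].
exists i, j, k; split; [lia | lia | lia | by [] |].
by apply/(linear_Zn_eq0 n5).
Qed.

(** Three terms can be removed while keeping multiplicities at least 2, 2, 1. The remaining [n - 3]
    terms are not zero-sum-free, because [n < (n - 3) + 4]. *)
Lemma short_zero_sum_two_large n (x y z : 'Z_n) a b c :
  8 <= n -> x != y -> x != z -> y != z ->
  1 < a -> 1 < b -> 0 < c -> a + b + c = n ->
  short_zero_sum x y z a b c (n - 3).
Proof.
move=> n8 xy xz yz a1 b1 c0 abc.
have [a' [b' [c' [[aa bb cc] [a2 b2 c1 abc']]]]] : exists a' b' c',
    [/\ a' <= a, b' <= b & c' <= c] /\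
    [/\ 1 < a', 1 < b', 0 < c' & a' + b' + c' = n - 3].
  (* If [c] is large, it absorbs the excess over [x^2 y^2], and [n >= 8] keeps [n - 7] positive.
     Otherwise [c] is kept whole and [a] or [b] is shortened. *)
  have [cn|cn] := leqP c (n - 7); last by exists 2, 2, (n - 7); split; split; lia.
  have [an|an] := leqP a (n - 5 - c).
    by exists a, (n - 3 - c - a), c; split; split; lia.
  by exists (n - 5 - c), 2, c; split; split; lia.
apply: (short_zero_sum_not_free aa bb cc); first by rewrite abc'.
by apply: not_zero_sum_free3; rewrite // card_ord Zp_cast; lia.
Qed.

(** Either two multiplicities exceed 1, or two equal 1 and the third is [n - 2]; a permutation of
    the terms reaches one of the two treated shapes. *)
Lemma short_zero_sum_exists n (x y z : 'Z_n) a b c :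
  5 <= n -> x != y -> x != z -> y != z ->
  0 < a -> 0 < b -> 0 < c -> a + b + c = n ->
  short_zero_sum x y z a b c (n - 3).
Proof.
move=> n5 xy xz yz a0 b0 c0 abc.
have [n8|n8] := ltnP n 8; first by apply: short_zero_sum_small => //; rewrite n5.
have [yx zx zy] : [/\ y != x, z != x & z != y] by split; rewrite eq_sym.
have [a1|a1] := ltnP 1 a; have [b1|b1] := ltnP 1 b.
- exact: short_zero_sum_two_large.
- have -> : b = 1 by lia.
  have [c1|c1] := ltnP 1 c.
    apply/short_zero_sum_swap12/short_zero_sum_swap13.
    by apply: short_zero_sum_two_large => //; lia.
  have -> : c = 1 by lia.
  have -> : a = n - 2 by lia.
  exact: short_zero_sum_two_singletons.
- have [c1|c1] := ltnP 1 c.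
    apply: short_zero_sum_swap13.
    by apply: short_zero_sum_two_large => //; lia.
  have -> : c = 1 by lia.
  have -> : a = 1 by lia.
  have -> : b = n - 2 by lia.
  exact/short_zero_sum_swap12/short_zero_sum_two_singletons.
- have -> : a = 1 by lia.
  have -> : b = 1 by lia.
  have -> : c = n - 2 by lia.
  exact/short_zero_sum_swap13/short_zero_sum_two_singletons.
Qed.

(** * Generators, sharpness and the final assembly *)

Lemma generator_Zn_mulrn_eq0 n (g : 'Z_n) m :
  1 < n -> generator [set: 'Z_n]%SET g -> (g *+ m = 0)%R -> n %| m.
Proof.
move=> n1 /eqP gen gm.
have <- : #[g]%g = n by rewrite /order -gen cardsT card_ord Zp_cast.
by rewrite order_dvdn FinRing.zmodXgE gm.
Qed.

Theorem corollary4p2 (n : nat) (hn : 5 <= n) :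
  (forall S : {mset 'Z_n},
      size S = n -> #|` finsupp S| = 3 -> enat_le (MZ S) (Some (n - 3))) /\
  (forall g : 'Z_n,
      generator [set: 'Z_n]%SET g ->
      MZ (msetn (n - 2) g `+` [mset (g *+ 2)%R] `+` [mset (g *+ 3)%R]) =
        Some (n - 3)).
Proof.
have n1 : 1 < n by lia.
split=> [S sizeS supp3|g gen].
  have [x [y [z suppS]]] : exists x y z, finsupp S = [:: x; y; z] :> seq 'Z_n.
    by move: supp3; case: (finsupp S : seq 'Z_n)
      => [|x [|y [|z []]]] // _; exists x, y, z.
  have in_S u : (u \in S) = (u \in [:: x; y; z]) by rewrite -suppS msuppE.
  have := fset_uniq (finsupp S); rewrite suppS /= !inE negb_or andbT.
  case/andP=> /andP[xy xz] yz.
  have SE := mset3_counts xy xz yz (fun u => etrans (esym (in_S u)) : _ -> _).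
  have pos u : u \in [:: x; y; z] -> 0 < S u by rewrite -in_S in_mset.
  have sz : S x + S y + S z = n by rewrite -(size_mset3 x y z) -SE.
  have [i [j [k [ia jb kc /andP[s0 sL] E]]]] :
      short_zero_sum x y z (S x) (S y) (S z) (n - 3).
    by apply: short_zero_sum_exists => //; apply: pos; rewrite !inE eqxx ?orbT.
  apply: MZ_le sL; rewrite SE; apply/zero_sum_length_mset3P => //.
  by exists i, j, k.
(* Needed to see that [g], [2g], [3g] are distinct, so that the description by three multiplicities
   applies. *)
have neq i j : i < j < i + n -> (g *+ i)%R != (g *+ j)%R.
  case/andP=> ij ji; apply/eqP => E.
  have : n %| j - i.
    apply: generator_Zn_mulrn_eq0 gen _ => //.
    by rewrite mulrnBr ?(ltnW ij) // E subrr.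
  by move/dvdn_leq; lia.
have g2 : g != (g *+ 2)%R by apply: (neq 1 2); lia.
have g3 : g != (g *+ 3)%R by apply: (neq 1 3); lia.
have g23 : (g *+ 2 != g *+ 3)%R by apply: neq; lia.
have gE i j k : (g *+ i + g *+ 2 *+ j + g *+ 3 *+ k = g *+ (i + 2 * j + 3 * k))%R.
  by rewrite -!mulrnA -!mulrnDr.
apply: MZ_eq => [|r].
  (* The weights add up to [(n - 5) + 2 + 3 = n]. *)
  apply/zero_sum_length_mset3P => //; exists (n - 5), 1, 1.
  split; [lia | by [] | by [] | lia |].
  have -> : (g *+ (n - 5) + g *+ 2 *+ 1 + g *+ 3 *+ 1 = g *+ n)%R.
    by rewrite gE; congr (_ *+ _)%R; lia.
  by rewrite -mulr_natr pchar_Zp ?mulr0.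
case/zero_sum_length_mset3P => // i [j [k [ia jb kc [r0 rE]]]].
(* The weight [i + 2j + 3k] is a positive multiple of [n] and equals [r + j + 2k], at most
   [r + 3]. *)
rewrite gE => /(generator_Zn_mulrn_eq0 n1 gen) /dvdn_leq; lia.
Qed.
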